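(* Under the standing assumptions in the context, let $(\hat x,\hat y)\in X\times Y$ and put $\hat{\mathsf W}_y:=\mathsf W_Y(\hat y,-\nabla_yF(\hat x,\hat y),L_{yy})$ and $\hat{\mathsf S}_y:=\mathsf S_Y(\hat y,-\nabla_yF(\hat x,\hat y),L_{yy})$. Then $$\|\nabla\varphi_{2L_{xx}}(\hat x)\|^2=O\left(\mathsf S_X^2(\hat x,\nabla_xF(\hat x,\hat y),L_{xx})+L_{xx}R_y\hat{\mathsf W}_y+\frac{L_{xx}\big(\hat{\mathsf S}_y^2-\hat{\mathsf W}_y^2\big)}{L_{yy}}\right),$$ where $O(\cdot)$ hides an absolute constant. As a result, $\|\nabla\varphi_{2L_{xx}}(\hat x)\|=O(\varepsilon_x)$ (with an absolute constant) whenever $(\hat x,\hat y)$ is an $(\varepsilon_x,\varepsilon_y)$-approximate first-order Nash equilibrium with $$\varepsilon_y\le\min\left[\frac{\varepsilon_x^2}{L_{xx}R_y},\ \varepsilon_x\sqrt{\frac{L_{yy}}{L_{xx}}}\,\right].$$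
   Context: Standing assumptions. $X$ and $Y$ are convex sets with non-empty interior in finite-dimensional Euclidean spaces $\mathcal X,\mathcal Y$, onto which Euclidean projection is well defined; $Y$ is compact and contained in a Euclidean ball of radius $R_y<\infty$. $\|\cdot\|$, $\langle\cdot,\cdot\rangle$ are the Euclidean norm and inner product. The function $F:X\times Y\to\mathbb R$ is concave in $y$ for every $x\in X$ (not necessarily convex in $x$) and differentiable, with partial gradients satisfying, for all $x,x'\in X$, $y,y'\in Y$ and constants $L_{xx},L_{yy},L_{xy}$ (with $L_{xx},L_{yy}>0$): $\|\nabla_xF(x',y)-\nabla_xF(x,y)\|\le L_{xx}\|x'-x\|$, $\|\nabla_yF(x,y')-\nabla_yF(x,y)\|\le L_{yy}\|y'-y\|$, $\|\nabla_xF(x,y')-\nabla_xF(x,y)\|\le L_{xy}\|y'-y\|$, $\|\nabla_yF(x',y)-\nabla_yF(x,y)\|\le L_{xy}\|x'-x\|$. Primal function and its standard Moreau envelope: $\varphi(x):=\max_{y\in Y}F(x,y)$ and $\varphi_{2L_{xx}}(x):=\min_{x'\in X}[\varphi(x')+L_{xx}\|x'-x\|^2]$. Stationarity measures. For a convex set $Z$ in a Euclidean space, $z\in Z$, a vector $\zeta$, and $L>0$: $$\mathsf S_Z^2(z,\zeta,L):=2L\max_{z'\in Z}\left[-\langle\zeta,z'-z\rangle-\tfrac L2\|z'-z\|^2\right]\ (\mathsf S_Z\ge0),\qquad \mathsf W_Z(z,\zeta,L):=L\left\|z-\Pi_Z\left[z-\tfrac1L\zeta\right]\right\|,$$ where $\Pi_Z$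 is the Euclidean projection onto $Z$. A point $(\hat x,\hat y)\in X\times Y$ is an $(\varepsilon_x,\varepsilon_y)$-approximate first-order Nash equilibrium of $\min_{x\in X}\max_{y\in Y}F(x,y)$ if $\mathsf S_X(\hat x,\nabla_xF(\hat x,\hat y),L_{xx})\le\varepsilon_x$ and $\mathsf S_Y(\hat y,-\nabla_yF(\hat x,\hat y),L_{yy})\le\varepsilon_y$. *)

(* Defs.v *)
From HB Require Import structures.
From mathcomp Require Import all_boot all_order all_algebra.
From mathcomp Require Import all_classical all_reals all_analysis.

Set Implicit Arguments.
Unset Strict Implicit.
Unset Printing Implicit Defensive.

Import Order.TTheory GRing.Theory Num.Theory.
Import numFieldNormedType.Exports.

Local Open Scope classical_set_scope.
Local Open Scope ring_scope.

(* The library norm on 'rV[R]_n is the sup norm: it is used only where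
   the choice of norm is irrelevant (topology, [differentiable]).  All metric
   quantities use the Euclidean norm [enorm]. *)
Definition edot (R : realType) (n : nat) (u v : 'rV[R]_n) : R :=
  \sum_(i < n) u 0 i * v 0 i.

Definition enorm (R : realType) (n : nat) (u : 'rV[R]_n) : R :=
  Num.sqrt (edot u u).

Definition is_proj (R : realType) (n : nat) (Z : set 'rV[R]_n)
    (z p : 'rV[R]_n) : Prop :=
  Z p /\ forall q, Z q -> enorm (z - p) <= enorm (z - q).

Definition proj_well_defined (R : realType) (n : nat) (Z : set 'rV[R]_n) :
    Prop :=
  forall z, exists! p, is_proj Z z p.

Definition proj (R : realType) (n : nat) (Z : set 'rV[R]_n) (z : 'rV[R]_n) :
    'rV[R]_n :=
  xget 0 [set p | is_proj Z z p].

(* Joint (Frechet) differentiability of F at (x, y) relative to X * Y, with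
   partial gradients gx and gy.  The increments range over X * Y only, since F
   is meaningful only there; boundary points are allowed.  When X and Y are
   convex with non-empty interior, (gx, gy) is unique. *)
Definition has_gradients_on (R : realType) (n m : nat)
    (X : set 'rV[R]_n) (Y : set 'rV[R]_m) (F : 'rV[R]_n -> 'rV[R]_m -> R)
    (x : 'rV[R]_n) (y : 'rV[R]_m) (gx : 'rV[R]_n) (gy : 'rV[R]_m) : Prop :=
  forall e : R, 0 < e ->
    \forall p \near within (X `*` Y) (nbhs (x, y)),
      `|F p.1 p.2 - F x y - edot gx (p.1 - x) - edot gy (p.2 - y)|
        <= e * (enorm (p.1 - x) + enorm (p.2 - y)).

Definition grad (R : realType) (n : nat) (f : 'rV[R]_n -> R)
    (x : 'rV[R]_n) : 'rV[R]_n :=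
  \row_(i < n) 'D_(delta_mx 0 i) f x.

(* In the definitions below, maxima and minima are written as suprema and
   infima; they are attained when Y is compact, X and Z are
   closed and convex, F is smooth and L is large enough (L > 0 for [stat_Ssq],
   phi + L * enorm _ ^+ 2 strongly convex for [moreau]). *)
Definition primal (R : realType) (n m : nat) (Y : set 'rV[R]_m)
    (F : 'rV[R]_n -> 'rV[R]_m -> R) (x : 'rV[R]_n) : R :=
  sup [set F x y | y in Y].

(* [moreau X phi L] is the envelope written phi_{2 L} in the literature. *)
Definition moreau (R : realType) (n : nat) (X : set 'rV[R]_n)
    (phi : 'rV[R]_n -> R) (L : R) (x : 'rV[R]_n) : R :=
  inf [set phi x' + L * enorm (x' - x) ^+ 2 | x' in X].

Definition stat_Ssq (R : realType) (n : nat) (Z : set 'rV[R]_n)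
    (z zeta : 'rV[R]_n) (L : R) : R :=
  2 * L * sup [set - edot zeta (z' - z) - L / 2 * enorm (z' - z) ^+ 2
              | z' in Z].

Definition stat_S (R : realType) (n : nat) (Z : set 'rV[R]_n)
    (z zeta : 'rV[R]_n) (L : R) : R :=
  Num.sqrt (stat_Ssq Z z zeta L).

Definition stat_W (R : realType) (n : nat) (Z : set 'rV[R]_n)
    (z zeta : 'rV[R]_n) (L : R) : R :=
  L * enorm (z - proj Z (z - L^-1 *: zeta)).

(* [gxF] and [gyF] are the partial gradients of the objective function. *)
Definition approx_FNE (R : realType) (n m : nat)
    (X : set 'rV[R]_n) (Y : set 'rV[R]_m)
    (gxF : 'rV[R]_n -> 'rV[R]_m -> 'rV[R]_n)
    (gyF : 'rV[R]_n -> 'rV[R]_m -> 'rV[R]_m)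
    (Lxx Lyy epsx epsy : R) (x : 'rV[R]_n) (y : 'rV[R]_m) : Prop :=
  [/\ X x, Y y,
      stat_S X x (gxF x y) Lxx <= epsx &
      stat_S Y y (- gyF x y) Lyy <= epsy].

(* Main.v *)
Require Import Defs.
From HB Require Import structures.
From mathcomp Require Import all_boot all_order all_algebra.
From mathcomp Require Import ring lra.
From mathcomp Require Import all_classical all_reals all_analysis.

Import Order.TTheory GRing.Theory Num.Theory.
Import numFieldNormedType.Exports.

Local Open Scope classical_set_scope.
Local Open Scope ring_scope.

(** The Moreau envelope of the primal function phi is smooth because phi is
weakly convex.  At a point a of X and for a nearly maximizing y, the quadratic
lower bound of F(., y) given by the Lipschitz x-gradient is, up to an arbitrary
error e, a quadratic minorant of phi with curvature - Lxx: this is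
[primal_weakly_convex].  Hence phi + Lxx |. - x|^2 is Lxx-strongly convex on X,
so its minimizing sequences are Cauchy and it has a minimizer p
([prox_exists]), around which it grows at least like (Lxx / 2) |. - p|^2
([prox_growth]).  Growth at two neighbouring base points bounds the variation
of p, and the envelope is therefore differentiable with gradient
2 Lxx (x - p) ([moreau_gradient]).

It remains to bound d = |x - p|.  Growth at p compared with x, together with
phi p >= F(p, y) and the quadratic lower bound of F(., y) at x, gives
  Lxx d^2 <= (phi x - F(x, y)) - <gx, p - x>,
while - <gx, p - x> - (Lxx / 2) d^2 <= S_X^2 / (2 Lxx) by definition of S_X.
The gap phi x - F(x, y) is at most the maximum over y' in Y of
<gy, y' - y> by concavity, which [linear_gap_le] bounds by
(S_Y^2 - W_Y^2) / (2 Lyy) + 2 Ry W_Y, using the variational inequality of the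
projected gradient step.  Multiplying by 8 Lxx yields
  |grad|^2 <= 4 S_X^2 + 16 Lxx Ry W_Y + 4 Lxx (S_Y^2 - W_Y^2) / Lyy,
whence the constant 16; and since W_Y <= S_Y, each of the three terms is at
most epsx^2 at an approximate equilibrium, so |grad|^2 <= 24 epsx^2 and 5 is an
admissible second constant. *)

(** * Euclidean inner product *)

Section Euclid.
Context {R : realType} {n : nat}.
Implicit Types u v w : 'rV[R]_n.

Lemma edotC u v : edot u v = edot v u.
Proof. by apply: eq_bigr => i _; rewrite mulrC. Qed.

Lemma edotDl u v w : edot (u + v) w = edot u w + edot v w.
Proof. by rewrite -big_split; apply: eq_bigr => i _; rewrite mxE mulrDl. Qed.

Lemma edotZl a u w : edot (a *: u) w = a * edot u w.
Proof. by rewrite mulr_sumr; apply: eq_bigr => i _; rewrite mxE mulrA. Qed.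

Lemma edotNl u w : edot (- u) w = - edot u w.
Proof. by rewrite -scaleN1r edotZl mulN1r. Qed.

Lemma edotDr w u v : edot w (u + v) = edot w u + edot w v.
Proof. by rewrite !(edotC w) edotDl. Qed.

Lemma edotZr a w u : edot w (a *: u) = a * edot w u.
Proof. by rewrite !(edotC w) edotZl. Qed.

Lemma edotNr w u : edot w (- u) = - edot w u.
Proof. by rewrite !(edotC w) edotNl. Qed.

Definition edotE := (edotDl, edotDr, edotNl, edotNr, edotZl, edotZr).

Lemma edot0r u : edot u 0 = 0.
Proof. by rewrite -(scale0r 0) edotZr mul0r. Qed.

Lemma edot_ge0 u : 0 <= edot u u.
Proof. by apply: sumr_ge0 => i _; rewrite -expr2 sqr_ge0. Qed.

Lemma enorm_ge0 u : 0 <= enorm u.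
Proof. exact: sqrtr_ge0. Qed.

Lemma sqr_enorm u : enorm u ^+ 2 = edot u u.
Proof. by rewrite sqr_sqrtr ?edot_ge0. Qed.

Lemma enorm0 : enorm (0 : 'rV[R]_n) = 0.
Proof. by rewrite /enorm edot0r sqrtr0. Qed.

Lemma enormZ a u : enorm (a *: u) = `|a| * enorm u.
Proof. by rewrite /enorm !edotE mulrA -expr2 sqrtrM ?sqr_ge0 // sqrtr_sqr. Qed.

Lemma enormN u : enorm (- u) = enorm u.
Proof. by rewrite /enorm !edotE opprK. Qed.

Lemma normr_coord_le_enorm u i : `|u 0 i| <= enorm u.
Proof.
rewrite -[`|_|]sqrtr_sqr // /enorm ler_sqrt ?edot_ge0 // expr2.
rewrite /edot (bigD1 i) //= lerDl; apply: sumr_ge0 => j _.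
by rewrite -expr2 sqr_ge0.
Qed.

Lemma enorm_eq0 u : enorm u = 0 -> u = 0.
Proof.
move=> u0; apply/rowP => i; rewrite mxE.
by have := normr_coord_le_enorm u i; rewrite u0 normr_le0 => /eqP.
Qed.

(** Cauchy-Schwarz inequality. *)
Lemma edot_le_enorm u v : edot u v <= enorm u * enorm v.
Proof.
have [v0|v0] := eqVneq (edot v v) 0.
  rewrite [v]enorm_eq0 ?edot0r ?enorm0 ?mulr0 //.
  by rewrite /enorm v0 sqrtr0.
apply: le_trans (ler_norm _) _.
rewrite -[`|_|]sqrtr_sqr // -sqrtrM ?edot_ge0 //.
rewrite ler_sqrt ?mulr_ge0 ?edot_ge0 //.
have vgt : 0 < edot v v by rewrite lt_neqAle eq_sym v0 edot_ge0.
have := edot_ge0 (edot v v *: u - edot u v *: v).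
rewrite !edotE (edotC v u) => h.
rewrite -(ler_pM2l vgt) -subr_ge0; apply: le_trans h _.
by rewrite le_eqVlt; apply/orP; left; apply/eqP; ring.
Qed.

Lemma norm_edot_le u v : `|edot u v| <= enorm u * enorm v.
Proof.
by rewrite ler_norml edot_le_enorm andbT lerNl -edotNl -(enormN u) edot_le_enorm.
Qed.

(** The Euclidean norm and the sup norm of row vectors are equivalent. *)
Lemma mx_norm_le_enorm u : `|u| <= enorm u.
Proof.
have -> : `|u| = mx_norm u by [].
rewrite mx_normrE; apply: bigmax_le => [|[i j] _ /=]; first exact: enorm_ge0.
by rewrite ord1 normr_coord_le_enorm.
Qed.

Lemma enorm_le_mx_norm u : enorm u <= Num.sqrt n%:R * `|u|.
Proof.
rewrite -(normr_id u) -(sqrtr_sqr `|u|) -sqrtrM ?ler0n //.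
rewrite ler_sqrt ?mulr_ge0 ?ler0n ?sqr_ge0 //.
have -> : n%:R * `|u| ^+ 2 = \sum_(i < n) `|u| ^+ 2.
  by rewrite sumr_const card_ord mulr_natl.
apply: ler_sum => i _; rewrite -expr2 -[_ ^+ 2]real_normK ?num_real //.
rewrite ler_pXn2r ?nnegrE ?normr_ge0 //.
have -> : `|u| = mx_norm u by [].
rewrite mx_normrE; exact: (@le_bigmax _ _ _ _ (fun ij => `|u ij.1 ij.2|) (0, i)).
Qed.
End Euclid.

(** * Derivatives along segments *)

Section SegmentCalculus.
Context {R : realType}.

(** Letting t tend to 0. *)
Lemma le_of_vanishing_slack (A B K : R) :
  (forall t, 0 < t -> t <= 1 -> B <= A + t * K) -> B <= A.
Proof.
move=> h; apply/ler_addgt0Pr => e e0.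
pose t := Num.min 1 (e / (`|K| + 1)).
have K1 : 0 < `|K| + 1 by rewrite ltr_wpDl.
have t0 : 0 < t by rewrite lt_min ltr01 divr_gt0.
have t1 : t <= 1 by rewrite ge_min lexx.
apply: le_trans (h t t0 t1) _; rewrite lerD2l.
apply: le_trans (_ : t * (`|K| + 1) <= _).
  by rewrite ler_pM2l // (le_trans (ler_norm K)) // lerDl.
by rewrite -ler_pdivlMr // ge_min lexx orbT.
Qed.

Lemma convex_set_segment {V : lmodType R} (Z : set V) (a b : V) (t : R) :
  convex_set Z -> Z a -> Z b -> 0 <= t -> t <= 1 -> Z (a + t *: (b - a)).
Proof.
move=> cZ Za Zb t0 t1; have := cZ b a (Itv01 t0 t1); rewrite !inE.
move=> /(_ Zb Za); congr (Z _).
change (t *: b + (1 - t) *: a = a + t *: (b - a)).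
by rewrite scalerBr scalerBl scale1r addrCA addrA.
Qed.

(** Differentiability relative to X * Y restricts to a segment of X * Y; one of
dx and dy may be 0, which gives the partial derivatives. *)
Lemma has_gradients_on_segment n m (X : set 'rV[R]_n) (Y : set 'rV[R]_m)
    (F : 'rV[R]_n -> 'rV[R]_m -> R) (x dx gx : 'rV[R]_n) (y dy gy : 'rV[R]_m)
    (t : R) :
  has_gradients_on X Y F (x + t *: dx) (y + t *: dy) gx gy ->
  forall e, 0 < e -> \forall s \near t,
    X (x + s *: dx) -> Y (y + s *: dy) ->
    `|F (x + s *: dx) (y + s *: dy) - F (x + t *: dx) (y + t *: dy)
      - (s - t) * (edot gx dx + edot gy dy)| <= e * `|s - t|.
Proof.
move=> gF e e0.
pose M := enorm dx + enorm dy + 1.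
have M0 : 0 < M by rewrite ltr_wpDl // addr_ge0 ?enorm_ge0.
have := gF (e / M) (divr_gt0 e0 M0).
pose g (s : R) : 'rV[R]_n * 'rV[R]_m := (x + s *: dx, y + s *: dy).
have ca (k : nat) (z d : 'rV[R]_k) : (z + s *: d) @[s --> t] --> z + t *: d.
  by apply: cvgD; [exact: cvg_cst|exact: scalel_continuous].
have cg : g @ t --> g t by exact: (cvg_pair (ca _ x dx) (ca _ y dy)).
rewrite near_withinE => /cg cgF; move: cgF.
apply: (@filterS _ (nbhs t)) => s /= h Xs Ys; have := h (conj Xs Ys).
have E (k : nat) (z d : 'rV[R]_k) : z + s *: d - (z + t *: d) = (s - t) *: d.
  by rewrite opprD addrACA subrr add0r scalerBl.
rewrite !E !edotZr !enormZ [(s - t) * (_ + _)]mulrDr opprD addrA => /le_trans; apply.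
rewrite -mulrDr.
rewrite mulrCA mulrC ler_wpM2r // mulrAC ler_pdivrMr // ler_wpM2l ?ltW //.
by rewrite /M ltrDl.
Qed.

Lemma is_derive_of_near (f : R -> R) (t l : R) :
  (forall e, 0 < e -> \forall s \near t,
    `|f s - f t - (s - t) * l| <= e * `|s - t|) ->
  is_derive t (1 : R) f l.
Proof.
move=> h.
have H : (fun k : R => k^-1 *: ((f \o shift t) (k *: (1 : R)) - f t)) @ 0^' --> l.
  apply/cvgrPdist_le => e e0; have := h e e0.
  move=> /nbhs_normP[r /= r0 hr].
  have kr : \forall k \near (0 : R), `|k| < r by exact: nbhs0_lt.
  rewrite near_withinE; apply: filterS kr => k kr k0.
  have /hr : ball_ Num.Def.normr t r (k + t).
    by rewrite /ball_ /= opprD addrCA subrr addr0 normrN.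
  rewrite /= addrK /GRing.scale /= mulr1 => hk.
  rewrite -(ler_pM2r (_ : 0 < `|k|)) ?normr_gt0 // -normrM.
  apply: le_trans hk; rewrite -normrN le_eqVlt; apply/orP; left; apply/eqP.
  congr `|_|; field; exact: k0.
have D : derivable f t 1 by apply/cvg_ex; exists l.
by split => //; apply/cvg_lim.
Qed.

(** Expansions and derivatives are only required relative to [0, 1], so that
one-sided information at the end points is enough. *)
Lemma le_of_derivative_ge0 (f df : R -> R) :
  (forall t : R, 0 <= t <= 1 -> forall e : R, 0 < e -> \forall s \near t,
    0 <= s <= 1 -> `|f s - f t - (s - t) * df t| <= e * `|s - t|) ->
  (forall t : R, 0 <= t <= 1 -> 0 <= df t) -> f 0 <= f 1.
Proof.
move=> fdf df0.
have [||c c01 fE] := @MVT R f df 0 1 ltr01.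
- move=> t; rewrite in_itv /= => /andP[t0 t1].
  apply: is_derive_of_near => e e0.
  have t01 : 0 <= t <= 1 by rewrite !ltW.
  have := fdf t t01 e e0.
  have tin : t \in `]0, 1[%R by rewrite in_itv /= t0 t1.
  apply: filterS2 (near_in_itvoo tin).
  by move=> s; rewrite /= in_itv /= => /andP[/ltW -> /ltW ->]; exact.
- apply/subspace_continuousP => t; rewrite /= in_itv /= => t01.
  apply/cvgrPdist_le => e e0; rewrite near_withinE.
  have := fdf t t01 1 ltr01.
  have k0 : 0 < e / (1 + `|df t|) by rewrite divr_gt0 // ltr_pwDl.
  apply: filterS2; last exact: (nbhsx_ballx t _ k0).
  move=> s; rewrite /ball /= => ts; rewrite in_itv /= mul1r => /[apply] h.
  rewrite distrC -[f s - f t](subrK ((s - t) * df t)).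
  apply: le_trans (ler_normD _ _) _; apply: le_trans (lerD h (lexx _)) _.
  rewrite normrM -[X in X + _]mulr1 -mulrDr -ler_pdivlMr ?ltr_pwDl //.
  by rewrite distrC ltW.
- rewrite -subr_ge0 fE subr0 mulr1 df0 //.
  by move: c01; rewrite in_itv /= => /andP[/ltW -> /ltW ->].
Qed.

End SegmentCalculus.

(** * Smooth and concave functions, projections *)

Section SmoothFunctions.
Context {R : realType}.

Lemma segment_lower_bound (f df : R -> R) (l K : R) : 0 <= K ->
  (forall t : R, 0 <= t <= 1 -> forall e : R, 0 < e -> \forall s \near t,
    0 <= s <= 1 -> `|f s - f t - (s - t) * df t| <= e * `|s - t|) ->
  (forall t : R, 0 <= t <= 1 -> l - K * t <= df t) ->
  f 0 + l - K / 2 <= f 1.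
Proof.
move=> K0 fdf df_ge.
(* h has derivative df t - l + K * t, which is nonnegative. *)
pose h t := f t - t * l + K / 2 * t ^+ 2.
suff : h 0 <= h 1 by rewrite /h; lra.
apply: (@le_of_derivative_ge0 R h (fun t => df t - l + K * t)) => t t01; last first.
  by have := df_ge t t01; lra.
move=> e e0.
have e20 : 0 < e / 2 by rewrite divr_gt0.
have r0 : 0 < e / (K + 1) by rewrite divr_gt0 // ltr_wpDl.
apply: filterS2 (fdf t t01 _ e20) (nbhsx_ballx t _ r0) => s fs ts s01.
have {}fs := fs s01.
have -> : h s - h t - (s - t) * (df t - l + K * t)
  = (f s - f t - (s - t) * df t) + K / 2 * (s - t) ^+ 2 by rewrite /h; field.
apply: le_trans (ler_normD _ _) _.
rewrite [e in leRHS]splitr [leRHS]mulrDl lerD //.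
rewrite normrM ger0_norm ?divr_ge0 // normrX expr2 mulrA ler_wpM2r //.
rewrite /ball /= distrC ltr_pdivlMr ?ltr_wpDl // in ts.
have : K * `|s - t| <= `|s - t| * (K + 1) by rewrite mulrDr mulr1 mulrC lerDl.
move: ts; lra.
Qed.

Context {n m : nat}.
Implicit Types (X : set 'rV[R]_n) (Y : set 'rV[R]_m).
Implicit Type F : 'rV[R]_n -> 'rV[R]_m -> R.

(** The x-gradient is L-Lipschitz on the convex set X, hence the derivative of
F along the segment from x to x' is at least
edot (gx x) d - L * t * enorm d ^+ 2 at time t, where d = x' - x; integrate
this. *)
Lemma smooth_lower_bound X Y F (gx : 'rV[R]_n -> 'rV[R]_n)
    (gy : 'rV[R]_n -> 'rV[R]_m) (L : R) (y : 'rV[R]_m) :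
  convex_set X -> Y y -> 0 <= L ->
  (forall x, X x -> has_gradients_on X Y F x y (gx x) (gy x)) ->
  (forall x x', X x -> X x' -> enorm (gx x' - gx x) <= L * enorm (x' - x)) ->
  forall x x', X x -> X x' ->
  F x y + edot (gx x) (x' - x) - L / 2 * enorm (x' - x) ^+ 2 <= F x' y.
Proof.
move=> cX Yy L0 gF gL x x' Xx Xx'.
set d := x' - x.
have Xs s : 0 <= s <= 1 -> X (x + s *: d).
  by move=> /andP[s0 s1]; exact: convex_set_segment.
have := @segment_lower_bound (fun t => F (x + t *: d) y)
  (fun t => edot (gx (x + t *: d)) d) (edot (gx x) d) (L * enorm d ^+ 2).
have -> : x + 1 *: d = x' by rewrite scale1r addrC subrK.
rewrite scale0r addr0 => H.
rewrite -addrA -[L / 2 * _]mulrAC addrA; apply: H.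
- by rewrite mulr_ge0 ?sqr_ge0.
- move=> t t01 e e0.
  have := @has_gradients_on_segment R n m X Y F x d (gx (x + t *: d)) y 0
    (gy (x + t *: d)) t.
  rewrite scaler0 addr0 => /(_ (gF _ (Xs _ t01)) e e0).
  apply: filterS => s H s01; have := H (Xs _ s01).
  by rewrite scaler0 addr0 edot0r addr0; exact.
- move=> t t01; have := gL _ _ Xx (Xs _ t01); case/andP: (t01) => t0 _.
  rewrite addrAC subrr add0r enormZ (ger0_norm t0) => gLt.
  have := edot_le_enorm (gx x - gx (x + t *: d)) d.
  rewrite -enormN opprB edotDl edotNl.
  have := ler_wpM2r (enorm_ge0 d) gLt; rewrite -/d; lra.
Qed.

(** A concave function lies below its tangent, also at a boundary point of Y:
the difference quotients along a chord are at least F x y' - F x y. *)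
Lemma concave_upper_bound X Y F (x gx : 'rV[R]_n) (y gy : 'rV[R]_m) :
  convex_set Y -> convex_function Y (fun y => - F x y) -> X x -> Y y ->
  has_gradients_on X Y F x y gx gy ->
  forall y', Y y' -> F x y' <= F x y + edot gy (y' - y).
Proof.
move=> cY cF Xx Yy gF y' Yy'; apply/ler_addgt0Pr => e e0.
set d := y' - y.
have := @has_gradients_on_segment R n m X Y F x 0 gx y d gy 0.
rewrite !scale0r !addr0 => /(_ gF e e0) /nbhs_normP[r /= r0 hr].
pose s := Num.min 1 (r / 2).
have r20 : 0 < r / 2 by rewrite divr_gt0.
have s0 : 0 < s by rewrite lt_min ltr01.
have s1 : s <= 1 by rewrite ge_min lexx.
have sr : s < r.
  by rewrite (le_lt_trans (_ : s <= r / 2)) ?ge_min ?lexx ?orbT //; lra.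
have := hr s; rewrite /ball_ /= sub0r normrN (gtr0_norm s0) => /(_ sr).
rewrite scaler0 !addr0 => /(_ Xx).
have Ys : Y (y + s *: d) by apply: convex_set_segment => //; exact: ltW.
move=> /(_ Ys); rewrite edot0r add0r subr0 (gtr0_norm s0).
rewrite ler_norml => /andP[_ h].
have := cF (Itv01 (ltW s0) s1) y' y; rewrite !inE => /(_ Yy' Yy).
have -> : conv (Itv01 (ltW s0) s1) (y' : convex_lmodType 'rV[R]_m) y
    = y + s *: d.
  change (s *: y' + (1 - s) *: y = y + s *: (y' - y)).
  by rewrite scalerBr scalerBl scale1r addrCA addrA.
change (- F x (y + s *: d) <= s * (- F x y') + (1 - s) * (- F x y) -> 
  F x y' <= F x y + edot gy d + e) => c.
rewrite -(ler_pM2l s0); move: h c; lra.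
Qed.

End SmoothFunctions.

Section Projection.
Context {R : realType} {n : nat}.
Implicit Types (Z : set 'rV[R]_n) (z w p q : 'rV[R]_n).

Lemma projP Z w : proj_well_defined Z -> is_proj Z w (Defs.proj Z w).
Proof.
by move=> /(_ w)[p [pP _]]; apply: (@xgetPex _ 0 [set p | is_proj Z w p]); exists p.
Qed.

Lemma proj_variational Z w p : convex_set Z -> is_proj Z w p ->
  forall q, Z q -> edot (w - p) (q - p) <= 0.
Proof.
move=> cZ [Zp pmin] q Zq.
apply: (@le_of_vanishing_slack R _ _ (enorm (q - p) ^+ 2 / 2)) => t t0 t1.
have := pmin _ (convex_set_segment _ _ _ _ cZ Zp Zq (ltW t0) t1).
rewrite -(ler_pXn2r (n := 2)) ?nnegrE ?enorm_ge0 // !sqr_enorm opprD addrA.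
move: (w - p) (q - p) => u v.
rewrite !edotE (edotC v u) => h; rewrite -(ler_pM2l t0); move: h; lra.
Qed.

Lemma proj_step_variational Z z zeta (L : R) : convex_set Z ->
  proj_well_defined Z -> 0 < L ->
  let p := Defs.proj Z (z - L^-1 *: zeta) in
  Z p /\ forall q, Z q -> edot (L *: (z - p) - zeta) (q - p) <= 0.
Proof.
move=> cZ pZ L0 p.
have pP : is_proj Z (z - L^-1 *: zeta) p by exact: projP.
split=> [|q Zq]; first by case: pP.
have := proj_variational _ _ _ cZ pP q Zq; rewrite addrAC.
have -> : z - p - L^-1 *: zeta = L^-1 *: (L *: (z - p) - zeta).
  by rewrite scalerBr scalerA mulVf ?gt_eqF // scale1r.
by rewrite edotZl pmulr_rle0 ?invr_gt0.
Qed.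

(** The maximum defining S ^ 2 is attained at the projected gradient step. *)
Lemma stat_Ssq_proj Z z zeta (L : R) : convex_set Z -> proj_well_defined Z ->
  0 < L -> Z z ->
  stat_Ssq Z z zeta L
    = 2 * L * edot zeta (z - Defs.proj Z (z - L^-1 *: zeta))
      - stat_W Z z zeta L ^+ 2.
Proof.
move=> cZ pZ L0 Zz; rewrite /stat_W.
have [] := proj_step_variational Z z zeta L cZ pZ L0.
set p := Defs.proj _ _ => Zp pV.
have -> : stat_Ssq Z z zeta L
    = 2 * L * (- edot zeta (p - z) - L / 2 * enorm (p - z) ^+ 2).
  rewrite /stat_Ssq; congr (_ * _).
  have ub : ubound [set - edot zeta (z' - z) - L / 2 * enorm (z' - z) ^+ 2
              | z' in Z] (- edot zeta (p - z) - L / 2 * enorm (p - z) ^+ 2).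
    move=> _ [q Zq <-]; have := pV q Zq.
    have -> : q - z = (q - p) + (p - z) by rewrite addrA subrK.
    rewrite -(opprB p z) !sqr_enorm; move: (q - p) (p - z) => u v.
    rewrite !edotE (edotC v u).
    have := mulr_ge0 (ltW L0) (edot_ge0 u); lra.
  apply/eqP; rewrite eq_le; apply/andP; split.
    apply: ge_sup => //.
    by exists (- edot zeta (p - z) - L / 2 * enorm (p - z) ^+ 2), p.
  by apply: ub_le_sup; [eexists; exact: ub|exists p].
by rewrite -(opprB z p) enormN exprMn edotNr; field.
Qed.

Lemma sqr_stat_S Z z zeta (L : R) : convex_set Z -> proj_well_defined Z ->
  0 < L -> Z z -> stat_S Z z zeta L ^+ 2 = stat_Ssq Z z zeta L /\
  stat_W Z z zeta L ^+ 2 <= stat_Ssq Z z zeta L.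
Proof.
move=> cZ pZ L0 Zz.
have WS : stat_W Z z zeta L ^+ 2 <= stat_Ssq Z z zeta L.
  rewrite stat_Ssq_proj // /stat_W.
  have [_ /(_ z Zz)] := proj_step_variational Z z zeta L cZ pZ L0.
  move: (z - Defs.proj _ _) => u; rewrite exprMn sqr_enorm !edotE => h.
  have := ler_wpM2l (ltW L0) h; lra.
by split => //; rewrite /stat_S sqr_sqrtr // (le_trans _ WS) // sqr_ge0.
Qed.

Lemma stat_W_le_stat_S Z z zeta (L : R) : convex_set Z ->
  proj_well_defined Z -> 0 < L -> Z z -> stat_W Z z zeta L <= stat_S Z z zeta L.
Proof.
move=> cZ pZ L0 Zz; have [SS WS] := sqr_stat_S Z z zeta L cZ pZ L0 Zz.
have W0 : 0 <= stat_W Z z zeta L by rewrite mulr_ge0 ?enorm_ge0 ?ltW.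
by rewrite -(ler_pXn2r (n := 2)) ?nnegrE ?sqrtr_ge0 // SS.
Qed.

(** The slack of the linearised problem at z is controlled by the two
stationarity measures.  With p the projected gradient step from z, the value
of - edot zeta (p - z) is (S ^ 2 + W ^ 2) / (2 L), and moving on from p to q
gains at most W * enorm (q - z) - W ^ 2 / L. *)
Lemma linear_gap_le Z z zeta (L : R) : convex_set Z -> proj_well_defined Z ->
  0 < L -> Z z -> forall q, Z q ->
  - edot zeta (q - z)
    <= (stat_S Z z zeta L ^+ 2 - stat_W Z z zeta L ^+ 2) / (2 * L)
       + stat_W Z z zeta L * enorm (q - z).
Proof.
move=> cZ pZ L0 Zz q Zq; have [-> _] := sqr_stat_S Z z zeta L cZ pZ L0 Zz.
rewrite stat_Ssq_proj // /stat_W.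
have [_ /(_ q Zq)] := proj_step_variational Z z zeta L cZ pZ L0.
set p := Defs.proj _ _.
have -> : q - p = (q - z) + (z - p) by rewrite addrA subrK.
move: (z - p) (q - z) => u v P.
have := edot_le_enorm (- u) v; rewrite enormN edotNl => CS.
have -> : (2 * L * edot zeta u - (L * enorm u) ^+ 2 - (L * enorm u) ^+ 2)
    / (2 * L) = edot zeta u - L * edot u u.
  by rewrite exprMn sqr_enorm; field; rewrite gt_eqF.
have := ler_wpM2l (ltW L0) CS.
move: P; rewrite !edotE; lra.
Qed.

(** The objective whose supremum defines S is at most S ^ 2 / (2 * L); it follows
from [linear_gap_le] by completing the square W - L * enorm (q - z). *)
Lemma stat_S_upper_bound Z z zeta (L : R) : convex_set Z ->
  proj_well_defined Z -> 0 < L -> Z z -> forall q, Z q ->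
  2 * L * (- edot zeta (q - z)) - (L * enorm (q - z)) ^+ 2
    <= stat_S Z z zeta L ^+ 2.
Proof.
move=> cZ pZ L0 Zz q Zq.
have L20 : 0 < 2 * L by rewrite mulr_gt0.
have := linear_gap_le Z z zeta L cZ pZ L0 Zz q Zq.
rewrite -(ler_pM2l L20) mulrDr (mulrCA _ _ (_ ^-1)) mulfV ?gt_eqF // mulr1.
have := sqr_ge0 (stat_W Z z zeta L - L * enorm (q - z)); lra.
Qed.

End Projection.

(** * Differentiability in the Euclidean norm *)

(** Differentiability from an explicit candidate for the differential. *)
Lemma differentiable_of_near (R : realType) (V W : normedModType R)
    (f : V -> W) (df : {linear V -> W}) (x : V) : continuous df ->
  (forall e : R, 0 < e -> \forall h \near (0 : V),
    `|f (h + x) - f x - df h| <= e * `|h|) ->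
  differentiable f x /\ 'd f x = df :> (V -> W).
Proof.
move=> dfc fdf.
have fo : f \o shift x = cst (f x) + df +o_ 0 id.
  apply/eqaddoP => e e0; have := fdf e e0.
  by apply: filterS => h; rewrite -addrA -opprD.
have dE : 'd f x = df :> (V -> W) by exact: diff_unique.
by split => //; apply/diff_locallyP; rewrite dE.
Qed.

Section EuclideanDifferential.
Context {R : realType} {n : nat}.

Lemma edot_is_linear (g : 'rV[R]_n) : linear (edot g : 'rV[R]_n -> R).
Proof. by move=> a u v; rewrite !edotE. Qed.

HB.instance Definition _ (g : 'rV[R]_n) :=
  GRing.isLinear.Build R 'rV[R]_n R *:%R (edot g) (edot_is_linear g).

Lemma edot_continuous (g : 'rV[R]_n) : continuous (edot g : 'rV[R]_n -> R).
Proof.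
apply: continuous_big => [|i _ u]; first exact: add_continuous.
apply: (@continuous_comp _ _ _ (fun v : 'rV[R]_n => v 0 i) ( *%R (g 0 i)) u).
  exact: coord_continuous.
exact: mulrl_continuous.
Qed.

Lemma edot_delta (g : 'rV[R]_n) i : edot g (delta_mx 0 i) = g 0 i.
Proof.
rewrite /edot (bigD1 i) //= mxE !eqxx mulr1 big1 ?addr0 // => j ji.
by rewrite mxE (negbTE ji) andbF mulr0.
Qed.

(** A quadratic remainder in the Euclidean norm gives differentiability for
the sup norm, the two norms being equivalent. *)
Lemma differentiable_of_quadratic_remainder (f : 'rV[R]_n -> R)
    (x g : 'rV[R]_n) (C : R) : 0 <= C ->
  (forall h, `|f (x + h) - f x - edot g h| <= C * enorm h ^+ 2) ->
  differentiable f x /\ grad f x = g.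
Proof.
move=> C0 fg.
have [||fd dE] := @differentiable_of_near R 'rV[R]_n R f (edot g) x.
- exact: edot_continuous.
- move=> e e0; pose K := C * n%:R + 1.
  have K0 : 0 < K by rewrite ltr_wpDl // mulr_ge0.
  have ek : 0 < e / K by rewrite divr_gt0.
  have := @nbhs0_lt R 'rV[R]_n _ ek.
  apply: filterS => h hs; rewrite (addrC h); apply: le_trans (fg h) _.
  rewrite ltr_pdivlMr // in hs.
  have n0 : 0 <= Num.sqrt n%:R * `|h| by rewrite mulr_ge0 ?sqrtr_ge0.
  have := enorm_le_mx_norm h.
  rewrite -(ler_pXn2r (n := 2)) ?nnegrE ?enorm_ge0 // exprMn.
  rewrite (sqr_sqrtr (ler0n R n)).
  move=> /(ler_wpM2l C0)/le_trans; apply.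
  rewrite expr2 !mulrA ler_wpM2r // (le_trans _ (ltW hs)) //.
  by rewrite mulrC ler_wpM2l // /K lerDl.
split => //; apply/rowP => i; rewrite mxE deriveE // dE.
exact: edot_delta.
Qed.

End EuclideanDifferential.

(** * Moreau envelope of a weakly convex function *)

Section MoreauEnvelope.
Context {R : realType} {n : nat}.
Implicit Types (X : set 'rV[R]_n) (x p z : 'rV[R]_n).

(** L-weak convexity of phi on X (convexity of phi + (L / 2) |.|^2), in the form
of approximate quadratic minorants: at each point a of X and for
each e > 0, phi has on X a concave quadratic minorant of curvature - L that is
within e of phi at a.  The error e allows phi to be a supremum that is not known
to be attained; such minorants also make phi lower semicontinuous on X. *)
Definition approx_weakly_convex X (phi : 'rV[R]_n -> R) (L : R) : Prop :=
  forall a, X a -> forall e : R, 0 < e -> exists g : 'rV[R]_n,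
    forall x, X x ->
      phi a - e + edot g (x - a) - L / 2 * enorm (x - a) ^+ 2 <= phi x.

(** p is a proximal point of x0: it minimizes phi + L |. - x0|^2 over X. *)
Definition is_prox X (phi : 'rV[R]_n -> R) (L : R) x0 p : Prop :=
  X p /\ forall x, X x ->
    phi p + L * enorm (p - x0) ^+ 2 <= phi x + L * enorm (x - x0) ^+ 2.

(** A set with well-defined projection is closed. *)
Lemma closure_of_proj_well_defined X z : proj_well_defined X ->
  (forall e : R, 0 < e -> exists2 x, X x & enorm (x - z) <= e) -> X z.
Proof.
move=> /(_ z)[p [[Xp pmin] _]] zX.
suff : enorm (z - p) = 0 by move=> /enorm_eq0 /eqP; rewrite subr_eq0 => /eqP ->.
apply/eqP; rewrite eq_le enorm_ge0 andbT; apply/ler_addgt0Pr => e e0.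
have [x Xx xz] := zX e e0.
by rewrite add0r (le_trans (pmin x Xx)) // -enormN opprB.
Qed.

Variables (X : set 'rV[R]_n) (phi : 'rV[R]_n -> R) (L : R).
Hypotheses (cX : convex_set X) (pX : proj_well_defined X) (L0 : 0 < L).
Hypothesis (wc : approx_weakly_convex X phi L).

(** The proximal objective with base point x0; x0 may lie outside X. *)
Let G x0 x := phi x + L * enorm (x - x0) ^+ 2.

(** Average the minorants of phi at the intermediate point, evaluated at a and
at b; of the curvature 2 L of the quadratic term, L is left. *)
Lemma prox_objective_strongly_convex x0 a b (t : R) : X a -> X b ->
  0 <= t -> t <= 1 ->
  G x0 (a + t *: (b - a)) + L / 2 * (t * (1 - t)) * enorm (b - a) ^+ 2
    <= (1 - t) * G x0 a + t * G x0 b.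
Proof.
move=> Xa Xb t0 t1; apply/ler_addgt0Pr => e e0.
have t1' : 0 <= 1 - t by rewrite subr_ge0.
have [g gP] := wc _ (convex_set_segment _ _ _ _ cX Xa Xb t0 t1) e e0.
have := ler_wpM2l t1' (gP a Xa); have := ler_wpM2l t0 (gP b Xb).
rewrite /G; set z := a + t *: (b - a).
have -> : a - z = - (t *: (b - a)) by rewrite /z opprD addrA subrr add0r.
have -> : b - z = (1 - t) *: (b - a).
  by rewrite /z opprD addrA scalerBl scale1r.
have -> : z - x0 = (a - x0) + t *: (b - a) by rewrite /z addrAC.
have -> : b - x0 = (a - x0) + (b - a) by rewrite [RHS]addrC addrA subrK.
move: (phi z) (a - x0) (b - a) => fz u d.
rewrite !sqr_enorm !edotE (edotC d u); lra.
Qed.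

Lemma prox_objective_lbound x0 : X !=set0 ->
  exists c, forall x, X x -> c <= G x0 x.
Proof.
move=> [a Xa]; have [g gP] := wc a Xa 1 ltr01.
pose w := g - (2 * L) *: (x0 - a).
(* Complete the square in x - a. *)
exists (phi a - 1 + L * edot (x0 - a) (x0 - a) - edot w w / (2 * L)).
move=> x Xx; apply: le_trans (_ : phi a - 1 + edot g (x - a)
  - L / 2 * enorm (x - a) ^+ 2 + L * enorm (x - x0) ^+ 2 <= _); last first.
  by rewrite lerD2r gP.
have -> : x - x0 = (x - a) - (x0 - a) by rewrite opprB addrA subrK.
have := edot_ge0 (L *: (x - a) + w).
have -> : g = w + (2 * L) *: (x0 - a) by rewrite subrK.
move: (x - a) (x0 - a) w => d v w.
rewrite !sqr_enorm !edotE (edotC d v) (edotC d w) => h.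
have : 0 <= (2 * L)^-1 * (L * (L * edot d d + edot w d) + L * edot w d
    + edot w w).
  by apply: mulr_ge0; [rewrite invr_ge0 mulr_ge0 // ltW|move: h; lra].
have -> : (2 * L)^-1 * (L * (L * edot d d + edot w d) + L * edot w d
    + edot w w) = L / 2 * edot d d + edot w d + edot w w / (2 * L).
  by field; rewrite gt_eqF.
lra.
Qed.

Lemma prox_exists x0 : X !=set0 -> exists p, is_prox X phi L x0 p.
Proof.
move=> X0; have [c cP] := prox_objective_lbound x0 X0.
pose I := inf [set G x0 x | x in X].
have IG x : X x -> I <= G x0 x.
  move=> Xx; apply: ge_inf; last by exists x.
  by exists c => _ [y Xy <-]; exact: cP.
have hI : has_inf [set G x0 x | x in X].
  split; first by case: X0 => a Xa; exists (G x0 a), a.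
  by exists c => _ [y Xy <-]; exact: cP.
have eps0 (k : nat) : 0 < k.+1%:R^-1 :> R by rewrite invr_gt0 ltr0Sn.
have uex k : exists x, X x /\ G x0 x < I + k.+1%:R^-1.
  by have [_ [x Xx <-] xI] := inf_adherent (eps0 k) hI; exists x.
have [u uP] := choice uex.
have uX k : X (u k) by case: (uP k).
have uI k : G x0 (u k) < I + k.+1%:R^-1 by case: (uP k).
have small (e : R) : 0 < e -> \forall k \near \oo, k.+1%:R^-1 < e.
  by move=> e0; exact: (near_infty_natSinv_lt (PosNum e0)).
(* Strong convexity at the midpoint of u k and u l, where the objective is at
   least its infimum I. *)
have udist k l : (l <= k)%N -> L / 8 * enorm (u k - u l) ^+ 2 <= l.+1%:R^-1.
  move=> lk.
  have kl : k.+1%:R^-1 <= l.+1%:R^-1 :> R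
    by rewrite lef_pV2 ?posrE ?ltr0Sn // ler_nat.
  have h0 : (0 : R) <= 1 / 2 by lra.
  have h1 : (1 / 2 : R) <= 1 by lra.
  have := prox_objective_strongly_convex x0 (u l) (u k) (1 / 2) (uX l) (uX k) h0 h1.
  have := IG _ (convex_set_segment _ _ _ _ cX (uX l) (uX k) h0 h1).
  have := uI k; have := uI l; move: kl.
  move: (k.+1%:R^-1) (l.+1%:R^-1) (G x0 _) (G x0 _) (G x0 _) => a b g1 g2 g3.
  lra.
have uC : cauchy (u @ \oo).
  apply: cauchy_exP => e e0.
  have e'0 : 0 < L / 8 * e ^+ 2 by rewrite mulr_gt0 ?divr_gt0 ?exprn_gt0.
  have [N _ NP] := small _ e'0.
  exists (u N); exists N => // k /= Nk.
  rewrite -ball_normE /= distrC (le_lt_trans (mx_norm_le_enorm _)) //.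
  rewrite -(ltr_pXn2r (n := 2)) ?nnegrE ?enorm_ge0 ?(ltW e0) //.
  rewrite -(ltr_pM2l (_ : 0 < L / 8)) ?divr_gt0 //.
  by apply: le_lt_trans (udist _ _ Nk) _; apply: NP => /=.
have /cvg_ex[z /= uz] : cvg (u @ \oo) by exact: cauchy_cvg.
have near_z (e : R) : 0 < e ->
    exists x, [/\ X x, G x0 x <= I + e & enorm (x - z) <= e].
  move=> e0.
  have s0 : 0 < e / (Num.sqrt n%:R + 1) by rewrite divr_gt0 // ltr_wpDl ?sqrtr_ge0.
  have := filterI (small e e0) ((cvgrPdist_lt _ _).1 uz _ s0).
  move=> [N _ /(_ N (leqnn N)) [/= Ne Nz]].
  exists (u N); split => //; first by rewrite (le_trans (ltW (uI N))) // lerD2l ltW.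
  apply: le_trans (enorm_le_mx_norm _) _; rewrite distrC.
  move: Nz; rewrite ltr_pdivlMr ?ltr_wpDl ?sqrtr_ge0 // => /ltW; apply: le_trans.
  by rewrite mulrC ler_wpM2l // lerDl.
have Xz : X z.
  apply: closure_of_proj_well_defined => // e e0.
  by have [x [Xx _ xz]] := near_z e e0; exists x.
(* Lower semicontinuity: use a minorant of phi at z, evaluated at points of X
   close to z and nearly minimizing. *)
exists z; split => // x Xx; apply: le_trans (IG x Xx).
apply/ler_addgt0Pr => e e0.
have e30 : 0 < e / 3 by rewrite divr_gt0.
have [g gP] := wc z Xz _ e30.
pose h := g + (2 * L) *: (z - x0).
have h1 : 0 < enorm h + 1 by rewrite ltr_wpDl ?enorm_ge0.
pose d := Num.min (e / 3) (e / 3 / (enorm h + 1)).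
have d0 : 0 < d by rewrite lt_min e30 divr_gt0.
have [y [Xy yI yz]] := near_z d d0.
have de : d <= e / 3 by rewrite ge_min lexx.
have dh : enorm h * enorm (y - z) <= e / 3.
  apply: le_trans (_ : (enorm h + 1) * d <= _).
    by rewrite ler_pM ?enorm_ge0 // lerDl.
  by rewrite mulrC -ler_pdivlMr // ge_min lexx orbT.
have := norm_edot_le h (y - z); rewrite ler_norml => /andP[hy _].
have := gP y Xy; move: yI; rewrite /G.
have -> : y - x0 = (y - z) + (z - x0) by rewrite addrA subrK.
have gE : edot h (y - z) = edot g (y - z) + 2 * L * edot (z - x0) (y - z).
  by rewrite /h edotDl edotZl.
have hy' : - (e / 3) <= edot g (y - z) + 2 * L * edot (z - x0) (y - z).
  by rewrite -gE; apply: le_trans hy; rewrite lerN2.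
have := mulr_ge0 (ltW L0) (edot_ge0 (y - z)).
move: hy' {gE hy dh yz}; move: (y - z) (z - x0) => a b.
rewrite !sqr_enorm !(edotDl, edotDr) (edotC a b).
move: de; lra.
Qed.

Lemma prox_growth x0 p x : is_prox X phi L x0 p -> X x ->
  G x0 p + L / 2 * enorm (x - p) ^+ 2 <= G x0 x.
Proof.
move=> [Xp pmin] Xx.
apply: (@le_of_vanishing_slack R _ _ (L / 2 * enorm (x - p) ^+ 2)) => t t0 t1.
have := prox_objective_strongly_convex x0 p x t Xp Xx (ltW t0) t1.
have := pmin _ (convex_set_segment _ _ _ _ cX Xp Xx (ltW t0) t1).
rewrite -!/(G _ _) => h1 h2; rewrite -(ler_pM2l t0); move: h1 h2.
move: (G x0 _) (G x0 p) (G x0 x) => g1 g2 g3; lra.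
Qed.

Lemma moreau_prox x0 p : is_prox X phi L x0 p -> moreau X phi L x0 = G x0 p.
Proof.
move=> [Xp pmin]; have lb : lbound [set G x0 x | x in X] (G x0 p).
  by move=> _ [x Xx <-]; exact: pmin.
apply/eqP; rewrite eq_le; apply/andP; split.
  by apply: ge_inf; [exists (G x0 p)|exists p].
by apply: lb_le_inf => //; exists (G x0 p), p.
Qed.

(** With q the proximal point of x0 + h, the two growth inequalities give
enorm (q - p) ^+ 2 <= 2 * edot (q - p) h, hence
edot (q - p) h <= 2 * enorm h ^+ 2; comparing both envelopes through p and
through q leaves a remainder between - 3 L |h|^2 and L |h|^2. *)
Lemma moreau_gradient x0 p : is_prox X phi L x0 p ->
  differentiable (moreau X phi L) x0 /\
  grad (moreau X phi L) x0 = (2 * L) *: (x0 - p).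
Proof.
move=> pP; have X0 : X !=set0 by exists p; case: pP.
apply: (@differentiable_of_quadratic_remainder _ _ _ _ _ (3 * L)).
  by rewrite mulr_ge0 // ltW.
move=> h; have [q qP] := prox_exists (x0 + h) X0.
rewrite (moreau_prox _ _ pP) (moreau_prox _ _ qP) ler_norml.
have := prox_growth _ _ q pP qP.1; have := prox_growth _ _ p qP pP.1.
rewrite /G.
have -> : q - (x0 + h) = (q - p) + (p - x0) - h.
  by rewrite addrA subrK opprD addrA.
have -> : q - x0 = (q - p) + (p - x0) by rewrite addrA subrK.
have -> : p - (x0 + h) = (p - x0) - h by rewrite opprD addrA.
rewrite -(opprB p x0) -(opprB q p).
have := mulr_ge0 (ltW L0) (edot_ge0 (q - p - 2 *: h)).
have := mulr_ge0 (ltW L0) (edot_ge0 (q - p)).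
have := mulr_ge0 (ltW L0) (edot_ge0 h).
move: (q - p) (p - x0) => a b.
rewrite !sqr_enorm !edotE (edotC a b) (edotC h a) (edotC h b).
move=> h1 h2 h3 h4 h5; apply/andP; split; move: h1 h2 h3 h4 h5; lra.
Qed.

End MoreauEnvelope.

(** * Primal function *)

Section PrimalFunction.
Context {R : realType} {n m : nat}.
Variables (X : set 'rV[R]_n) (Y : set 'rV[R]_m).
Variables (F : 'rV[R]_n -> 'rV[R]_m -> R).
Variables (gxF : 'rV[R]_n -> 'rV[R]_m -> 'rV[R]_n).
Variables (gyF : 'rV[R]_n -> 'rV[R]_m -> 'rV[R]_m).
Variables (Lxx Lyy Ry : R).
Hypotheses (cX : convex_set X) (pX : proj_well_defined X).
Hypotheses (cY : convex_set Y) (pY : proj_well_defined Y).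
Hypothesis (bY : exists c, forall y, Y y -> enorm (y - c) <= Ry).
Hypotheses (Lxx0 : 0 < Lxx) (Lyy0 : 0 < Lyy).
Hypothesis (cF : forall x, X x -> convex_function Y (fun y => - F x y)).
Hypothesis (dF : forall x y, X x -> Y y ->
  has_gradients_on X Y F x y (gxF x y) (gyF x y)).
Hypothesis (gxL : forall x x' y, X x -> X x' -> Y y ->
  enorm (gxF x' y - gxF x y) <= Lxx * enorm (x' - x)).

Lemma radius_ge0 y : Y y -> 0 <= Ry.
Proof. by case: bY => c yc /yc; apply: le_trans; exact: enorm_ge0. Qed.

Lemma diameter_le y y' : Y y -> Y y' -> enorm (y' - y) <= 2 * Ry.
Proof.
move=> Yy Yy'; have Ry0 := radius_ge0 y Yy; case: bY => c yc.
rewrite -(ler_pXn2r (n := 2)) ?nnegrE ?enorm_ge0 ?mulr_ge0 //.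
have sq z : Y z -> enorm (z - c) ^+ 2 <= Ry ^+ 2.
  by move=> Yz; rewrite ler_pXn2r ?nnegrE ?enorm_ge0 ?yc.
have := sq _ Yy; have := sq _ Yy'.
have := edot_ge0 ((y' - c) + (y - c)).
have -> : y' - y = (y' - c) - (y - c) by rewrite opprB addrA subrK.
move: (y' - c) (y - c) => a b.
rewrite !sqr_enorm !edotE; lra.
Qed.

Lemma primal_has_ubound x : X x -> has_ubound [set F x y | y in Y].
Proof.
move=> Xx; have [[y Yy]|Y0] := pselect (exists y, Y y); last first.
  by exists 0 => r [y Yy _]; case: Y0; exists y.
exists (F x y + enorm (gyF x y) * (2 * Ry)) => _ [y' Yy' <-].
have := concave_upper_bound X Y F x _ y _ cY (cF x Xx) Xx Yy (dF x y Xx Yy) y' Yy'.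
move=> /le_trans; apply.
rewrite lerD2l; apply: le_trans (edot_le_enorm _ _) _.
by rewrite ler_wpM2l ?enorm_ge0 ?diameter_le.
Qed.

Lemma le_primal x y : X x -> Y y -> F x y <= primal Y F x.
Proof.
by move=> Xx Yy; apply: (ub_le_sup (primal_has_ubound x Xx)); exists y.
Qed.

Lemma primal_weakly_convex : Y !=set0 -> approx_weakly_convex X (primal Y F) Lxx.
Proof.
move=> [y0 Yy0] a Xa e e0.
have hs : has_sup [set F a y | y in Y].
  by split; [exists (F a y0), y0|exact: primal_has_ubound].
have [_ [y Yy <-] ye] := sup_adherent e0 hs.
exists (gxF a y) => x Xx; apply: le_trans (le_primal x y Xx Yy).
apply: le_trans (smooth_lower_bound X Y F (gxF^~ y) (gyF^~ y) Lxx y cX Yy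
  (ltW Lxx0) _ _ a x Xa Xx); first by rewrite !lerD2r ltW.
- by move=> x' Xx'; exact: dF.
- by move=> x1 x2 X1 X2; exact: gxL.
Qed.

(** The gap is at most the maximal slack of the linearisation of F x at y, and
Y has diameter at most 2 * Ry. *)
Lemma primal_gap_le x y : X x -> Y y ->
  primal Y F x <= F x y
    + (stat_S Y y (- gyF x y) Lyy ^+ 2 - stat_W Y y (- gyF x y) Lyy ^+ 2)
      / (2 * Lyy)
    + stat_W Y y (- gyF x y) Lyy * (2 * Ry).
Proof.
move=> Xx Yy; apply: ge_sup; first by exists (F x y), y.
move=> _ [y' Yy' <-].
have := concave_upper_bound X Y F x _ y _ cY (cF x Xx) Xx Yy (dF x y Xx Yy) y' Yy'.
move=> /le_trans; apply.
rewrite -addrA lerD2l -[edot _ _]opprK -edotNl.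
apply: le_trans (linear_gap_le Y y _ Lyy cY pY Lyy0 Yy y' Yy') _.
rewrite lerD2l ler_wpM2l ?diameter_le //.
by rewrite mulr_ge0 ?enorm_ge0 // ltW.
Qed.

Lemma moreau_grad_bound x y : X x -> Y y ->
  differentiable (moreau X (primal Y F) Lxx) x /\
  enorm (grad (moreau X (primal Y F) Lxx) x) ^+ 2
    <= 4 * stat_S X x (gxF x y) Lxx ^+ 2
       + 16 * (Lxx * Ry * stat_W Y y (- gyF x y) Lyy)
       + 4 * (Lxx * (stat_S Y y (- gyF x y) Lyy ^+ 2
                     - stat_W Y y (- gyF x y) Lyy ^+ 2) / Lyy).
Proof.
move=> Xx Yy.
have Y0 : Y !=set0 by exists y.
have X0 : X !=set0 by exists x.
have wc := primal_weakly_convex Y0.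
have [p pP] := prox_exists X (primal Y F) Lxx cX pX Lxx0 wc x X0.
have [md ->] := moreau_gradient X (primal Y F) Lxx cX pX Lxx0 wc x p pP.
split => //.
have := prox_growth X (primal Y F) Lxx cX wc x p x pP Xx.
have Xp : X p by case: pP.
have := smooth_lower_bound X Y F (gxF^~ y) (gyF^~ y) Lxx y cX Yy (ltW Lxx0)
  (fun x' Xx' => dF x' y Xx' Yy) (fun x1 x2 X1 X2 => gxL x1 x2 y X1 X2 Yy)
  x p Xx Xp.
have := le_primal p y Xp Yy.
have := primal_gap_le x y Xx Yy.
have := stat_S_upper_bound X x (gxF x y) Lxx cX pX Lxx0 Xx p Xp.
rewrite subrr enorm0 enormZ gtr0_norm ?mulr_gt0 // -(opprB p x) enormN /=.
move: (stat_S X _ _ _) (stat_W Y _ _ _) (stat_S Y _ _ _) (enorm (p - x)).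
move: (primal Y F x) (primal Y F p) (F x y) (F p y) (edot _ _).
move=> f1 f2 f3 f4 g Sx W S d h1 h2 h3 h4 h5.
have -> : Lxx * (S ^+ 2 - W ^+ 2) / Lyy = 2 * Lxx * ((S ^+ 2 - W ^+ 2) / (2 * Lyy)).
  by field; rewrite gt_eqF.
move: ((S ^+ 2 - W ^+ 2) / _) h2 => D h2.
have h : Lxx * d ^+ 2 <= D + W * (2 * Ry) - g by move: h2 h3 h4 h5; lra.
have := ler_wpM2l (ltW Lxx0) h.
move: h1; lra.
Qed.

End PrimalFunction.

Theorem proposition5p5 (R : realType) :
  exists C C' : R, 0 < C /\ 0 < C' /\
  forall (n m : nat) (X : set 'rV[R]_n) (Y : set 'rV[R]_m)
    (F : 'rV[R]_n -> 'rV[R]_m -> R)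
    (gxF : 'rV[R]_n -> 'rV[R]_m -> 'rV[R]_n)
    (gyF : 'rV[R]_n -> 'rV[R]_m -> 'rV[R]_m)
    (Lxx Lyy Lxy Ry : R),
  convex_set X -> X° !=set0 -> proj_well_defined X ->
  convex_set Y -> Y° !=set0 -> proj_well_defined Y ->
  compact Y -> (exists c, forall y, Y y -> enorm (y - c) <= Ry) ->
  0 < Lxx -> 0 < Lyy ->
  (forall x, X x -> convex_function Y (fun y => - F x y)) ->
  (forall x y, X x -> Y y -> has_gradients_on X Y F x y (gxF x y) (gyF x y)) ->
  (forall x x' y, X x -> X x' -> Y y ->
    enorm (gxF x' y - gxF x y) <= Lxx * enorm (x' - x)) ->
  (forall x y y', X x -> Y y -> Y y' ->
    enorm (gyF x y' - gyF x y) <= Lyy * enorm (y' - y)) ->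
  (forall x y y', X x -> Y y -> Y y' ->
    enorm (gxF x y' - gxF x y) <= Lxy * enorm (y' - y)) ->
  (forall x x' y, X x -> X x' -> Y y ->
    enorm (gyF x' y - gyF x y) <= Lxy * enorm (x' - x)) ->
  forall (xh : 'rV[R]_n) (yh : 'rV[R]_m), X xh -> Y yh ->
  let env := moreau X (primal Y F) Lxx in
  let Wy := stat_W Y yh (- gyF xh yh) Lyy in
  let Sy := stat_S Y yh (- gyF xh yh) Lyy in
  differentiable env xh /\
  enorm (grad env xh) ^+ 2
    <= C * (stat_S X xh (gxF xh yh) Lxx ^+ 2 + Lxx * Ry * Wy
            + Lxx * (Sy ^+ 2 - Wy ^+ 2) / Lyy) /\
  forall epsx epsy : R,
    approx_FNE X Y gxF gyF Lxx Lyy epsx epsy xh yh ->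
    epsy <= Num.min (epsx ^+ 2 / (Lxx * Ry)) (epsx * Num.sqrt (Lyy / Lxx)) ->
    enorm (grad env xh) <= C' * epsx.
Proof.
(* 5 ^ 2 >= 4 + 16 + 4, the coefficients of [moreau_grad_bound]. *)
exists 16, 5; split; [by []|split; [by []|]].
move=> n m X Y F gxF gyF Lxx Lyy Lxy Ry cX _ pX cY _ pY _ bY Lxx0 Lyy0 cF dF
  gxL _ _ _ xh yh Xxh Yyh env Wy Sy.
have [denv] := moreau_grad_bound X Y F gxF gyF Lxx Lyy Ry cX pX cY pY bY Lxx0
  Lyy0 cF dF gxL xh yh Xxh Yyh.
rewrite -/env -/Wy -/Sy => bound.
have Ry0 : 0 <= Ry by exact: radius_ge0 bY yh Yyh.
have Wy0 : 0 <= Wy by rewrite mulr_ge0 ?enorm_ge0 // ltW.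
have Sy0 : 0 <= Sy by exact: sqrtr_ge0.
have WS : Wy <= Sy by exact: stat_W_le_stat_S.
have Sx0 : 0 <= stat_S X xh (gxF xh yh) Lxx by exact: sqrtr_ge0.
have tW : 0 <= Lxx * Ry * Wy by rewrite mulr_ge0 // mulr_ge0 // ltW.
have tS : 0 <= Lxx * (Sy ^+ 2 - Wy ^+ 2) / Lyy.
  apply: divr_ge0 (ltW Lyy0); apply: mulr_ge0 (ltW Lxx0) _.
  by rewrite subr_ge0 ler_pXn2r ?nnegrE.
split => //; split.
  by have := sqr_ge0 (stat_S X xh (gxF xh yh) Lxx); move: bound tW tS; lra.
move=> epsx epsy [_ _ Sxe Sye]; rewrite le_min => /andP[e1 e2].
have ex0 : 0 <= epsx by exact: le_trans Sxe.
have Sx2 : stat_S X xh (gxF xh yh) Lxx ^+ 2 <= epsx ^+ 2.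
  by rewrite ler_pXn2r ?nnegrE.
have W2 : Lxx * Ry * Wy <= epsx ^+ 2.
  (* When Ry = 0 the quotient by Lxx * Ry in the bound on epsy is 0, but the
     term to be bounded vanishes. *)
  have [->|R0] := eqVneq Ry 0; first by rewrite mulr0 mul0r sqr_ge0.
  have LR : 0 < Lxx * Ry by rewrite mulr_gt0 // lt_neqAle eq_sym R0.
  rewrite mulrC -ler_pdivlMr // (le_trans WS) // (le_trans Sye) //.
have S2 : Lxx * (Sy ^+ 2 - Wy ^+ 2) / Lyy <= epsx ^+ 2.
  have : Sy ^+ 2 <= (epsx * Num.sqrt (Lyy / Lxx)) ^+ 2.
    have := le_trans Sye e2; rewrite -/Sy => Se.
    by rewrite ler_pXn2r ?nnegrE // mulr_ge0 ?sqrtr_ge0.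
  rewrite exprMn (sqr_sqrtr (divr_ge0 (ltW Lyy0) (ltW Lxx0))) mulrA.
  rewrite ler_pdivlMr // ler_pdivrMr // => h.
  by have := mulr_ge0 (ltW Lxx0) (sqr_ge0 Wy); move: h; lra.
rewrite -(ler_pXn2r (n := 2)) ?nnegrE ?enorm_ge0 ?mulr_ge0 // exprMn.
by move: bound W2 S2 Sx2 (sqr_ge0 epsx); lra.
Qed.
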